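(* In the setting of the context (in which $R=0$), let $c\in(0,\nu/(2\delta))$ and suppose $0<\mu<\frac{1-\sigma_{\max}}{\delta}$ and $0<\alpha\le1$. Then there exists $\rho>0$ such that, with $$\nu_\rho=\min\Big\{\nu-2\delta c,\ \frac{\rho\,\underline\sigma\,c^2}{4(c^2+1)}\Big\}>0,\qquad \mathcal Q=I_{KM}-\alpha\mathcal B,\qquad \gamma=\max\big\{1-\mu\nu_\rho(2-\sigma_{\max}-\mu\delta),\ 1-\alpha\underline\sigma\big\},$$ one has $\mathcal Q>0$ (positive definite), $\gamma<1$, and for every sequence $(\mathbf w_i,\mathbf y_i,\mathbf z_i)$ generated by the recursion in the context with $\mathbf y_0=0$ (and arbitrary $\mathbf w_0$) there is a constant $C>0$ such that $$\|\mathbf w_i-\mathbf w^\star\|_{\mathcal Q}^2\le C\gamma^i\qquad\text{for all } i\ge0.$$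
   Context: Setting. $J_1,\dots,J_K:\mathbb R^M\to\mathbb R$ ($K\ge2$) are convex and differentiable with $\|\nabla J_k(u)-\nabla J_k(v)\|\le\delta\|u-v\|$ for all $u,v$; $\bar J(w)=\frac1K\sum_{k=1}^K J_k(w)$ satisfies $(u-v)^{\top}(\nabla\bar J(u)-\nabla\bar J(v))\ge\nu\|u-v\|^2$ for all $u,v$, with $0<\nu\le\delta$. The regularizer is $R=0$. The problem $\min_{w\in\mathbb R^M}\frac1K\sum_k J_k(w)$ has a (necessarily unique) solution $w^\star$, and $\mathbf w^\star=\mathbf 1_K\otimes w^\star$. $A\in\mathbb R^{K\times K}$ is symmetric, doubly stochastic (nonnegative entries, $A\mathbf 1_K=\mathbf 1_K$ and $\mathbf 1_K^{\top}A=\mathbf 1_K^{\top}$) and primitive (some power $A^p$ has all entries positive). $\mathcal B=\frac12(I_{KM}-A\otimes I_M)$ is symmetric positive semidefinite with eigenvalues in $[0,1)$; $\mathcal B^{1/2}$ is its positive semidefinite square root; $\sigma_{\max}$ is the largest singular value of $\mathcal B$ and $\underline\sigma$ its smallest nonzero singular value, so $0<\underline\sigma\le\sigma_{\max}<1$. For $\mathbf w=\mathrm{col}\{w_1,\dots,w_K\}\in\mathbb R^{KM}$: $\mathcal J(\mathbf w)=\sum_k J_k(w_k)$ and $\mathcal J_\mu(\mathbf w)=\mathcal J(\mathbf w)+\frac1{2\mu}\|\mathcal B^{1/2}\mathbf w\|^2$. Notation: $\|x\|_C^2=x^{\top}Cx$. Recursion: from initial $\mathbf w_0,\mathbf y_0\in\mathbb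 R^{KM}$, for $i\ge1$, $$\mathbf z_i=\mathbf w_{i-1}-\mu\nabla\mathcal J_\mu(\mathbf w_{i-1})-\mathcal B^{1/2}\mathbf y_{i-1},\quad \mathbf y_i=\mathbf y_{i-1}+\alpha\mathcal B^{1/2}\mathbf z_i,\quad \mathbf w_i=\mathbf z_i,$$ where the last step is the proximal step $\mathbf w_i=\arg\min_{\mathbf u}\{\sum_k R(u_k)+\frac{1}{2\mu}\|\mathbf u-\mathbf z_i\|^2\}$ with $R=0$. *)

(* Defs.v *)
From HB Require Import structures.
From mathcomp Require Import all_boot all_order all_algebra.
From mathcomp Require Import mxtens.
From mathcomp Require Import all_classical all_reals all_analysis.

Set Implicit Arguments.
Unset Strict Implicit.
Unset Printing Implicit Defensive.

Import Order.TTheory GRing.Theory Num.Theory.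
Import numFieldNormedType.Exports.

Local Open Scope ring_scope.

(* Vectors of R^n are columns 'cV[R]_n.  The library norm `|x| on matrices is
   the sup norm: it only supplies the topology used by differentiability.
   Metric estimates use the Euclidean norm and inner product below. *)
Section Euclidean.
Context {R : realType}.

Definition dotv n (x y : 'cV[R]_n) : R := (x^T *m y) 0 0.

Definition enorm n (x : 'cV[R]_n) : R := Num.sqrt (dotv x x).

Definition wnormsq n (C : 'M[R]_n) (x : 'cV[R]_n) : R := (x^T *m C *m x) 0 0.

Definition gradient n (f : 'cV[R]_n -> R) (x : 'cV[R]_n) : 'cV[R]_n :=
  \col_i 'D_(delta_mx i 0) (f : 'cV[R]_n -> R^o) x.

End Euclidean.

Section Matrices.
Context {R : realType}.

Definition psd n (C : 'M[R]_n) : Prop :=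
  C^T = C /\ forall x : 'cV[R]_n, 0 <= wnormsq C x.

Definition posdef n (C : 'M[R]_n) : Prop :=
  C^T = C /\ forall x : 'cV[R]_n, x != 0 -> 0 < wnormsq C x.

Definition psd_sqrt_of n (C S : 'M[R]_n) : Prop := psd S /\ S *m S = C.

Definition singular_value n (C : 'M[R]_n) (s : R) : Prop :=
  0 <= s /\ eigenvalue (C^T *m C) (s ^+ 2).

Definition largest_singular_value n (C : 'M[R]_n) (s : R) : Prop :=
  singular_value C s /\ forall t, singular_value C t -> t <= s.

Definition smallest_nonzero_singular_value n (C : 'M[R]_n) (s : R) : Prop :=
  [/\ singular_value C s, s != 0 &
      forall t, singular_value C t -> t != 0 -> s <= t].

Definition doubly_stochastic n (A : 'M[R]_n) : Prop :=
  [/\ forall i j, 0 <= A i j,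
      A *m const_mx 1 = (const_mx 1 : 'cV[R]_n) &
      const_mx 1 *m A = (const_mx 1 : 'rV[R]_n)].

Definition primitive n (A : 'M[R]_n) : Prop :=
  exists p : nat, forall i j, 0 < (A ^+ p) i j.

End Matrices.

(* Vectors of R^{KM} are indexed through the bijection mxtens_index between
   'I_K * 'I_M and 'I_(K * M), so that [block w k] is w_k in
   w = col{w_1, ..., w_K} and *t is the Kronecker product. *)
Section Network.
Context {R : realType}.
Variables K M : nat.

Definition block (w : 'cV[R]_(K * M)) (k : 'I_K) : 'cV[R]_M :=
  \col_j w (mxtens_index (k, j)) 0.

Definition kron_ones (w : 'cV[R]_M) : 'cV[R]_(K * M) :=
  (const_mx 1 : 'cV[R]_K) *t w.

Definition consensus_mx (A : 'M[R]_K) : 'M[R]_(K * M) :=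
  2^-1 *: (1%:M - A *t (1%:M : 'M[R]_M)).

Definition avg_cost (J : 'I_K -> 'cV[R]_M -> R) (w : 'cV[R]_M) : R :=
  K%:R^-1 * \sum_k J k w.

Definition sum_cost (J : 'I_K -> 'cV[R]_M -> R) (w : 'cV[R]_(K * M)) : R :=
  \sum_k J k (block w k).

(* [Bh] stands for the square root of the consensus matrix. *)
Definition penalized_cost (J : 'I_K -> 'cV[R]_M -> R) (Bh : 'M[R]_(K * M))
    (mu : R) (w : 'cV[R]_(K * M)) : R :=
  sum_cost J w + (2 * mu)^-1 * enorm (Bh *m w) ^+ 2.

(* The proximal step is the identity because the regularizer is zero. The
   recursion starts at index 1, so z 0 is unconstrained. *)
Definition primal_dual_recursion (J : 'I_K -> 'cV[R]_M -> R)
    (Bh : 'M[R]_(K * M)) (mu alpha : R) (w y z : nat -> 'cV[R]_(K * M)) : Prop :=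
  forall i : nat,
    [/\ z i.+1 = w i - mu *: gradient (penalized_cost J Bh mu) (w i)
                 - Bh *m y i,
        y i.+1 = y i + alpha *: (Bh *m z i.+1) &
        w i.+1 = z i.+1].

End Network.

(* Main.v *)
Require Import Defs.
From HB Require Import structures.
From mathcomp Require Import all_boot all_order all_algebra.
From mathcomp Require Import mxtens.
From mathcomp Require Import all_classical all_reals all_analysis.
From mathcomp Require Import complex ring lra.

Set Implicit Arguments.
Unset Strict Implicit.
Unset Printing Implicit Defensive.

Import Order.TTheory GRing.Theory Num.Theory.
Import numFieldNormedType.Exports.

Local Open Scope ring_scope.

(** The recursion is a gradient step on a penalized cost coupled to a dual
    ascent step. Write B for the consensus matrix, S for its square root, G w
    for the vector stacking the gradients of the J_k at the blocks of w, and ws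
    for wstar repeated K times.

    A fixed point. Connectivity of the network (primitivity of A) makes the
    kernel of B the space of vectors with equal blocks, so by symmetry the range
    of B is the space of vectors whose blocks sum to zero (consensus_range).
    Optimality of wstar says that the blocks of G ws sum to zero, hence
    G ws = B t for some t, and (ws, ys) with ys = - mu S t is a fixed point.
    Since y starts at 0, every error y_i - ys lies in the range of S, where
    |S y|^2 >= sigma_min |y|^2.

    An energy identity. Let e = w_i - ws, d = y_i - ys, g = G w_i - G ws and
    let x = e - mu g - B e be the error after the primal gradient step alone.
    The cross terms of the two updates cancel (primal_dual_energy):
      |w_(i+1) - ws|_Q^2 + |y_(i+1) - ys|^2 / alpha
        = |x|^2 + |d|^2 / alpha - |S d|^2,
    and the dual part of the right-hand side is at most
    (1 - alpha sigma_min) |d|^2 / alpha.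

    Contraction of the primal part. Each gradient of J_k is cocoercive with
    constant delta (cocoercive_gradient, the Baillon-Haddad theorem) and
    |B e|^2 <= sigma_max <e, B e>, so mu g + B e is cocoercive in e with
    constant mu delta + sigma_max, which gives (gradient_step_norm)
      |x|^2 <= |e|^2 - theta (mu <e, g> + <e, B e>),
    theta = 2 - sigma_max - mu delta. Only the average cost is strongly convex,
    but adding a multiple of the penalty <e, B e> restores the missing
    directions (consensus_decomposition, penalty_strengthens):
      <e, g> + rho <e, B e> >= nu_rho |e|^2    for every rho > 0.
    The step size condition says theta > 1, so rho can be chosen with
    theta (1 - mu rho) = 1. Then
      |x|^2 <= (1 - mu nu_rho theta) |e|^2 - <e, B e>,
    and the last term pays for replacing |e|^2 by |e|_Q^2 = |e|^2 -
    alpha <e, B e> because alpha <= 1. The energy therefore decreases by the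
    factor gamma at each step and dominates |w_i - ws|_Q^2.

    The spectral inequalities for B are read off from one statement: a real
    symmetric matrix has eigenvalues lam_i such that |x|^2, <x, C x> and
    |C x|^2 are the moments of order 0, 1, 2 of the lam_i for common
    nonnegative weights (symmetric_spectral_weights). *)

(** * Euclidean geometry of column vectors *)

Section EuclideanCalculus.
Context {R : realType} {n : nat}.
Implicit Types (x y z : 'cV[R]_n) (C : 'M[R]_n).

Lemma dotvE x y : dotv x y = \sum_i x i 0 * y i 0.
Proof. by rewrite /dotv mxE; apply: eq_bigr => i _; rewrite mxE. Qed.

Lemma dotvC x y : dotv x y = dotv y x.
Proof. by rewrite !dotvE; apply: eq_bigr => i _; rewrite mulrC. Qed.

Lemma dotvDr x y z : dotv x (y + z) = dotv x y + dotv x z.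
Proof. by rewrite /dotv mulmxDr mxE. Qed.

Lemma dotvDl x y z : dotv (y + z) x = dotv y x + dotv z x.
Proof. by rewrite dotvC dotvDr !(dotvC x). Qed.

Lemma dotvZr a x y : dotv x (a *: y) = a * dotv x y.
Proof. by rewrite /dotv -scalemxAr mxE. Qed.

Lemma dotvZl a x y : dotv (a *: x) y = a * dotv x y.
Proof. by rewrite dotvC dotvZr dotvC. Qed.

Lemma dotvNr x y : dotv x (- y) = - dotv x y.
Proof. by rewrite -scaleN1r dotvZr mulN1r. Qed.

Lemma dotvNl x y : dotv (- x) y = - dotv x y.
Proof. by rewrite dotvC dotvNr dotvC. Qed.

Definition dotv_expand :=
  (dotvDl, dotvDr, dotvNl, dotvNr, dotvZl, dotvZr).

Lemma dotv_suml (I : finType) (F : I -> 'cV[R]_n) x :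
  dotv (\sum_i F i) x = \sum_i dotv (F i) x.
Proof. by rewrite /dotv (raddf_sum (@trmx _ _ _)) mulmx_suml summxE. Qed.

Lemma dotv0r x : dotv x 0 = 0.
Proof. by rewrite /dotv mulmx0 mxE. Qed.

Lemma dotv_ge0 x : 0 <= dotv x x.
Proof. by rewrite dotvE sumr_ge0// => i _; rewrite -expr2 sqr_ge0. Qed.

Lemma dotv_eq0 x : (dotv x x == 0) = (x == 0).
Proof.
apply/idP/eqP => [|->]; last by rewrite dotv0r.
rewrite dotvE psumr_eq0 => [/allP x0|i _]; last by rewrite -expr2 sqr_ge0.
apply/colP => i; rewrite mxE; apply/eqP.
by have := x0 i (mem_index_enum i); rewrite mulf_eq0 orbb.
Qed.

Lemma enorm_sqr x : enorm x ^+ 2 = dotv x x.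
Proof. by rewrite sqr_sqrtr ?dotv_ge0. Qed.

Lemma enormN x : enorm (- x) = enorm x.
Proof. by rewrite /enorm dotvNl dotvNr opprK. Qed.

Lemma enorm_ge0 x : 0 <= enorm x.
Proof. exact: sqrtr_ge0. Qed.

Lemma cauchy_schwarz x y : dotv x y <= enorm x * enorm y.
Proof.
have [->|y0] := eqVneq y 0; first by rewrite dotv0r mulr_ge0 ?enorm_ge0.
have yy_gt0 : 0 < dotv y y by rewrite lt_neqAle eq_sym dotv_eq0 y0 dotv_ge0.
have := dotv_ge0 (dotv y y *: x - dotv x y *: y).
rewrite !dotv_expand (dotvC y x) => sq_ge0.
apply: (le_trans (ler_norm _)).
rewrite -[leRHS]ger0_norm ?mulr_ge0 ?enorm_ge0// -ler_sqr ?nnegrE//.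
rewrite !real_normK ?num_real// exprMn !enorm_sqr.
by rewrite -subr_ge0 -(pmulr_rge0 _ yy_gt0); nra.
Qed.

Lemma dotv_le_enorm x y a b :
  enorm x <= a -> enorm y <= b -> dotv x y <= a * b.
Proof.
move=> xa yb; apply: (le_trans (cauchy_schwarz x y)).
by rewrite ler_pM ?enorm_ge0.
Qed.

Lemma dotv_mulmx C x y : dotv x (C *m y) = dotv (C^T *m x) y.
Proof. by rewrite /dotv trmx_mul trmxK mulmxA. Qed.

Lemma wnormsqE C x : wnormsq C x = dotv x (C *m x).
Proof. by rewrite /wnormsq /dotv mulmxA. Qed.

Lemma dotv_delta x i : dotv x (delta_mx i 0) = x i 0.
Proof.
rewrite dotvE (bigD1 i)//= mxE !eqxx mulr1 big1 ?addr0// => j ji.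
by rewrite mxE (negPf ji) mulr0.
Qed.

End EuclideanCalculus.

(** * Quadratic forms and singular values *)

Section SymmetricSpectrum.
Context {R : realType} {n : nat}.
Variable C : 'M[R]_n.
Local Open Scope sesquilinear_scope.

Let r2c : {rmorphism R -> R[i]} := real_complex R.

Lemma eigenvalue_real_complex (a : R) :
  eigenvalue (map_mx r2c C) (r2c a) = eigenvalue C a.
Proof. by rewrite !eigenvalue_root_char -map_char_poly fmorph_root. Qed.

(** The weights are the squared moduli of the coordinates of x in a unitary
    eigenbasis over R[i]; the eigenvalues are real because the matrix is
    hermitian there. Having the same weights for all three forms turns every
    inequality between them into a pointwise one on the spectrum. *)
Lemma symmetric_spectral_weights : C^T = C ->
  exists lam : 'I_n -> R, (forall i, eigenvalue C (lam i)) /\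
  forall x : 'cV[R]_n, exists q : 'I_n -> R,
    [/\ forall i, 0 <= q i, dotv x x = \sum_i q i,
        dotv x (C *m x) = \sum_i lam i * q i &
        dotv (C *m x) (C *m x) = \sum_i lam i ^+ 2 * q i].
Proof.
move=> C_sym; pose Cc := map_mx r2c C.
have Cc_real : Cc \is a mxOver Num.real.
  by apply/mxOverP => i j; rewrite mxE; apply/complex_realP; exists (C i j).
have Cc_sym : Cc \is symmetricmx.
  by apply/is_hermitianmxP; rewrite expr0 scale1r map_mx_id // map_trmx C_sym.
have Cc_herm : Cc \is hermsymmx by exact: realsym_hermsym.
have /orthomx_spectralP := hermitian_normalmx Cc_herm.
have := hermitian_spectral_diag_real Cc_herm.
have := spectral_unitarymx Cc.
move: (spectralmx Cc) (spectral_diag Cc) => P D PU D_real CcE.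
have Punit : P \in unitmx := unitarymx_unit PU.
pose lam i := complex.Re (D 0 i).
have lamE i : r2c (lam i) = D 0 i by exact: (RRe_real (mxOverP D_real 0 i)).
exists lam; split=> [i|x].
  rewrite -eigenvalue_real_complex lamE; apply/eigenvalueP; exists (row i P).
    rewrite -/Cc CcE -row_mul !mulmxA mulmxV// mul1mx row_mul row_diag_mx.
    by rewrite -scalemxAl -rowE.
  apply/negP => /eqP /(congr1 (mulmx^~ (invmx P))) /eqP.
  rewrite mul0mx -row_mul mulmxV// => /eqP /rowP /(_ i) /eqP.
  by rewrite !mxE eqxx oner_eq0.
(* u is opaque so that entrywise rewriting does not unfold its product. *)
have [u uE] : exists u, u = P *m map_mx r2c x by exists (P *m map_mx r2c x).
pose q i := complex.Re (u i 0) ^+ 2 + complex.Im (u i 0) ^+ 2.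
have quadE (d : 'I_n -> R) (B : 'M[R]_n) :
    map_mx r2c B = invmx P *m diag_mx (\row_i r2c (d i)) *m P ->
    dotv x (B *m x) = \sum_i d i * q i.
  move=> BE; apply: (fmorph_inj r2c).
  rewrite rmorph_sum /dotv mulmxA.
  transitivity (map_mx r2c (x^T *m B *m x) 0 0); first by rewrite [RHS]mxE.
  rewrite !map_mxM BE invmx_unitary// -!mulmxA -uE mulmxA.
  have -> : map_mx r2c x^T *m P^t* = u^t*.
    rewrite uE trmx_mul map_mxM; congr (_ *m _).
    apply/matrixP => i j; rewrite !mxE; apply/esym/CrealP/complex_realP.
    by exists (x j i).
  rewrite mul_diag_mx mxE; apply: eq_bigr => i _.
  rewrite !mxE rmorphM [r2c (q i)]add_Re2_Im2 normCK.
  by rewrite mulrCA [X in _ * X]mulrC.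
have DE : \row_i r2c (lam i) = D by apply/rowP => i; rewrite mxE lamE.
have D2E : \row_i r2c (lam i ^+ 2) = \row_i (D 0 i * D 0 i).
  by apply/rowP => i; rewrite [LHS]mxE [RHS]mxE rmorphXn lamE expr2.
have Cc2E : Cc *m Cc = invmx P *m diag_mx (\row_i (D 0 i * D 0 i)) *m P.
  by rewrite -mulmx_diag {1}CcE {1}CcE !mulmxA mulmxK.
exists q; split.
- by move=> i; rewrite addr_ge0 ?sqr_ge0.
- rewrite -[X in dotv _ X]mul1mx (quadE (fun=> 1)).
    by apply: eq_bigr => i _; rewrite mul1r.
  have -> : \row_(i < n) r2c 1 = const_mx 1 by apply/rowP => i; rewrite !mxE.
  by rewrite diag_const_mx mulmx1 mulVmx// map_mx1.
- by apply: quadE; rewrite DE; exact: CcE.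
- have -> : dotv (C *m x) (C *m x) = dotv x ((C *m C) *m x).
    by rewrite -mulmxA [RHS]dotv_mulmx C_sym.
  by apply: (quadE (fun i => lam i ^+ 2)); rewrite D2E map_mxM; exact: Cc2E.
Qed.

End SymmetricSpectrum.

Section PositiveSemidefinite.
Context {R : realType} {n : nat}.
Variables (C : 'M[R]_n) (smax smin : R).
Hypotheses (C_sym : C^T = C) (C_psd : forall x, 0 <= dotv x (C *m x)).
Hypothesis smaxP : largest_singular_value C smax.
Hypothesis sminP : smallest_nonzero_singular_value C smin.

Lemma psd_eigenvalue_singular a : eigenvalue C a -> singular_value C a.
Proof.
move=> /eigenvalueP[v vC v0]; split; last first.
  apply/eigenvalueP; exists v => //.
  by rewrite C_sym mulmxA vC -scalemxAl vC scalerA expr2.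
have Cv : C *m v^T = a *: v^T by rewrite -{1}C_sym -trmx_mul vC linearZ.
have v_gt0 : 0 < dotv v^T v^T.
  by rewrite lt_neqAle dotv_ge0 eq_sym dotv_eq0 trmx_eq0 v0.
by have := C_psd v^T; rewrite Cv dotvZr pmulr_lge0.
Qed.

Lemma smin_gt0 : 0 < smin.
Proof. by case: sminP => -[? _] ? _; rewrite lt_neqAle eq_sym; apply/andP. Qed.

Lemma smin_le_smax : smin <= smax.
Proof. by case: sminP => ? _ _; case: smaxP => _; exact. Qed.

(** On the spectrum these read smin a <= a^2 <= smax a and a <= smax; the first
    one survives at a = 0, which is why smin need only bound the nonzero
    singular values. *)
Lemma psd_spectral_bounds x :
  [/\ smin * dotv x (C *m x) <= dotv (C *m x) (C *m x),
      dotv (C *m x) (C *m x) <= smax * dotv x (C *m x) &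
      dotv x (C *m x) <= smax * dotv x x].
Proof.
have [lam [lamP weights]] := symmetric_spectral_weights C_sym.
have [q [q_ge0 -> -> ->]] := weights x.
have lam_sv i := psd_eigenvalue_singular (lamP i).
have lam_ge0 i : 0 <= lam i by case: (lam_sv i).
have lam_le i : lam i <= smax by case: smaxP => _; apply.
split; rewrite mulr_sumr ler_sum// => i _; rewrite ?expr2.
- rewrite mulrA ler_wpM2r//.
  have [->|l0] := eqVneq (lam i) 0; first by rewrite !mulr0.
  by rewrite ler_wpM2r//; case: sminP => _ _; exact.
- by rewrite mulrA ler_wpM2r// ler_wpM2r.
- by rewrite ler_wpM2r.
Qed.

End PositiveSemidefinite.

(** * Convex functions with Lipschitz gradient *)

Section SmoothConvex.
Context {R : realType} {n : nat}.
Implicit Types (f : 'cV[R]_n -> R) (x y v : 'cV[R]_n).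

Lemma enormZ t v : 0 <= t -> enorm (t *: v) = t * enorm v.
Proof.
move=> t_ge0; rewrite /enorm dotvZl dotvZr mulrA -expr2 sqrtrM ?sqr_ge0//.
by rewrite sqrtr_sqr ger0_norm.
Qed.

Lemma derive_gradient f x v : differentiable (f : _ -> R^o) x ->
  'D_v (f : _ -> R^o) x = dotv (gradient f x) v.
Proof.
move=> df; rewrite deriveE// dotvE.
have vE : v = \sum_i v i 0 *: delta_mx i 0.
  apply/colP => j; rewrite summxE (bigD1 j)//= !mxE !eqxx mulr1 big1 ?addr0//.
  by move=> i ij; rewrite !mxE eq_sym (negPf ij) mulr0.
rewrite {1}vE linear_sum; apply: eq_bigr => i _.
by rewrite linearZ mxE deriveE// mulrC.
Qed.

(** A one-sided secant bound suffices because the derivative, once known to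
    exist, is the limit from the right. This gives both the tangent inequality
    for convex functions and the first-order condition at a minimizer. *)
Lemma derive_le_secant f x v m : derivable (f : _ -> R^o) x v ->
  (forall h, 0 < h < 1 -> f (h *: v + x) - f x <= h * m) ->
  'D_v (f : _ -> R^o) x <= m.
Proof.
move=> df fm; rewrite /derive (cvg_at_rightE _ _ df).
apply: limr_le.
  rewrite -(cvg_at_rightE _ _ df); apply: cvg_trans df.
  apply: cvg_app => A [e e_gt0 Ae]; exists e => // h he h_gt0.
  by apply: Ae => //; exact: lt0r_neq0.
near=> h.
have h_gt0 : 0 < h by near: h; exact: nbhs_right_gt.
have h_lt1 : h < 1 by near: h; exact: nbhs_right_lt.
rewrite /= /GRing.scale/= mulrC ler_pdivrMr// [leRHS]mulrC.
by apply: fm; rewrite h_gt0.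
Unshelve. all: by end_near. Qed.

Lemma convex_above_tangent f x y : convex_function setT f ->
  differentiable (f : _ -> R^o) x ->
  f x + dotv (gradient f x) (y - x) <= f y.
Proof.
move=> cf df; rewrite -lerBrDl -derive_gradient//.
apply: derive_le_secant => [|h /andP[h0 h1]]; first exact: diff_derivable.
pose t := Itv01 (ltW h0) (ltW h1).
have := cf t y x; rewrite !inE => /(_ Logic.I Logic.I).
(* Unfold convex combinations, in the space and in R. *)
change (f (h *: y + (1 - h) *: x) <= h * f y + (1 - h) * f x ->
        f (h *: (y - x) + x) - f x <= h * (f y - f x)).
have -> : h *: (y - x) + x = h *: y + (1 - h) *: x.
  by rewrite scalerBr scalerBl scale1r addrAC addrA.
lra.
Qed.

(** Chain rule for an inner map that is affine along the direction d; no
    differentiability of that map is involved, since the two difference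
    quotients coincide. *)
Lemma is_derive_affine_comp (W : normedModType R) f (L : W -> 'cV[R]_n) a d v :
  (forall h, L (h *: d + a) = h *: v + L a) ->
  differentiable (f : _ -> R^o) (L a) ->
  is_derive a d (fun s => f (L s) : R^o) (dotv (gradient f (L a)) v).
Proof.
move=> L_affine df.
have quotE : (fun h : R => h^-1 *:
      (((fun s => f (L s) : R^o) \o shift a) (h *: d) - f (L a))) =
    (fun h => h^-1 *: (((f : _ -> R^o) \o shift (L a)) (h *: v) - f (L a))).
  by apply/funext => h /=; rewrite L_affine.
split; first by rewrite /derivable quotE; exact: (diff_derivable df).
by rewrite -derive_gradient// /derive quotE.
Qed.

(** Descent lemma: on the segment from x to v + x, the difference between f and
    the parabola has nonpositive derivative by Cauchy-Schwarz and the Lipschitz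
    bound. *)
Lemma smooth_below_parabola f L x v :
  (forall z, differentiable (f : _ -> R^o) z) ->
  (forall y z, enorm (gradient f y - gradient f z) <= L * enorm (y - z)) ->
  f (v + x) <= f x + dotv (gradient f x) v + L / 2 * dotv v v.
Proof.
move=> df Lf.
pose a := dotv (gradient f x) v; pose b := L / 2 * dotv v v.
pose psi : R -> R := fun t => f (t *: v + x) - t * a - t * t * b.
have dpsi (t : R) : is_derive t (1 : R) psi
    (dotv (gradient f (t *: v + x)) v - a - t *+ 2 * b).
  have dline : is_derive t (1 : R) (fun s : R => f (s *: v + x) : R^o)
      (dotv (gradient f (t *: v + x)) v).
    apply: (is_derive_affine_comp (L := fun s : R => s *: v + x)) => // h.
    by rewrite -[h *: (1 : R)]/(h * 1) mulr1 scalerDl addrA.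
  have did := is_derive_id t (1 : R).
  have dlin : is_derive t (1 : R) (fun s : R => s * a) a.
    apply: (is_derive_eq (is_deriveM did (is_derive_cst a t 1))).
    by rewrite !scaler0 add0r /GRing.scale/= mulr1.
  have dquad : is_derive t (1 : R) (fun s : R => s * s * b) (t *+ 2 * b).
    have dsqr := is_deriveM did did.
    apply: (is_derive_eq (is_deriveM dsqr (is_derive_cst b t 1))).
    by rewrite !scaler0 add0r /GRing.scale/=; ring.
  exact: is_deriveB.
have [|t] := MVT ltr01 (fun t _ => dpsi t).
  by apply: derivable_within_continuous => s _; exact: ex_derive.
rewrite in_itv/= => /andP[t0 t1].
rewrite /psi scale1r scale0r add0r.
have : dotv (gradient f (t *: v + x) - gradient f x) v
    <= (L * (t * enorm v)) * enorm v.
  apply: dotv_le_enorm => //; rewrite (le_trans (Lf _ _))//.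
  by rewrite addrK enormZ// ltW.
rewrite dotvDl dotvNl -/a -/b.
have -> : L * (t * enorm v) * enorm v = t *+ 2 * b.
  by rewrite /b -enorm_sqr; field.
by move=> slope mvt; lra.
Qed.

(** Baillon-Haddad theorem. Compare the tangent at a with the parabola at b at
    the point b - g / L, where g is the difference of the gradients: this choice
    minimizes the parabola minus the tangent and strengthens the tangent
    inequality by |g|^2 / (2 L). Adding the two inequalities obtained by
    exchanging the points gives the claim. *)
Lemma cocoercive_gradient f L x y : 0 < L -> convex_function setT f ->
  (forall z, differentiable (f : _ -> R^o) z) ->
  (forall y z, enorm (gradient f y - gradient f z) <= L * enorm (y - z)) ->
  dotv (gradient f x - gradient f y) (gradient f x - gradient f y)
    <= L * dotv (x - y) (gradient f x - gradient f y).
Proof.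
move=> L0 cf df Lf.
have half a b : let g := gradient f b - gradient f a in
    f a + dotv (gradient f a) (b - a) + (2 * L)^-1 * dotv g g <= f b.
  move=> g.
  have gg : dotv g g = dotv (gradient f b) g - dotv (gradient f a) g.
    by rewrite {1}/g dotvDl dotvNl.
  clearbody g.
  have := smooth_below_parabola b (- (L^-1 *: g)) df Lf.
  have := convex_above_tangent (- (L^-1 *: g) + b) cf (df a).
  rewrite -(addrA (- _)) (dotvDr _ (- (L^-1 *: g))).
  rewrite !dotvNr !dotvNl !dotvZr !dotvZl opprK.
  have -> : L / 2 * (L^-1 * (L^-1 * dotv g g)) = (2 * L)^-1 * dotv g g.
    by field; rewrite gt_eqF.
  have -> : (2 * L)^-1 * dotv g g = 2^-1 * (L^-1 * dotv g g).
    by rewrite invfM mulrA.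
  have := congr1 (fun r => L^-1 * r) gg; rewrite mulrBr.
  lra.
have := half x y; have := half y x => /=.
rewrite -[y - x]opprB -[gradient f y - _]opprB.
move: (gradient f x) (gradient f y) => gx gy.
rewrite !dotvNr !dotvNl opprK (dotvC (x - y)) (dotvDl (x - y)) dotvNl => hx hy.
rewrite -ler_pdivrMl//.
move: hx hy; rewrite invfM; lra.
Qed.

End SmoothConvex.

Section QuadraticDerivative.
Context {R : realType} {n : nat}.
Local Open Scope classical_set_scope.
Local Open Scope ring_scope.

Lemma gradientP (f : 'cV[R]_n -> R) x g :
  (forall v, is_derive x v (f : _ -> R^o) (dotv g v)) -> gradient f x = g.
Proof.
move=> fg; apply/colP => i; rewrite mxE.
by have [_ ->] := fg (delta_mx i 0); rewrite dotv_delta.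
Qed.

(** Test the one-sided derivative in the direction - g. *)
Lemma minimizer_gradient0 (f : 'cV[R]_n -> R) x g :
  (forall v, is_derive x v (f : _ -> R^o) (dotv g v)) ->
  (forall y, f x <= f y) -> g = 0.
Proof.
move=> fg x_min; apply/eqP; rewrite -dotv_eq0 eq_le dotv_ge0 andbT.
have [df Dg] := fg (- g).
have : 'D_(- g) (- (f : _ -> R^o)) x <= 0.
  apply: derive_le_secant => [|h _]; first exact: derivableN.
  by rewrite mulr0 subr_le0 lerN2.
by rewrite deriveN// Dg dotvNr opprK.
Qed.

Lemma is_derive_quadratic (C : 'M[R]_n) x v : C^T = C ->
  is_derive x v (fun w => dotv w (C *m w) : R^o) (2 * dotv (C *m x) v).
Proof.
move=> C_sym.
have cvg_quot : (fun h : R => h^-1 *: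
      (((fun w => dotv w (C *m w) : R^o) \o shift x) (h *: v)
       - dotv x (C *m x)))
    @ 0^' --> (2 * dotv (C *m x) v : R^o).
  pose p : R -> R^o := fun h => 2 * dotv (C *m x) v + h * dotv v (C *m v).
  have p0 : p h @[h --> 0^'] --> (2 * dotv (C *m x) v : R^o).
    have -> : 2 * dotv (C *m x) v = 2 * dotv (C *m x) v + 0 * dotv v (C *m v).
      by rewrite mul0r addr0.
    apply: cvgD; first exact: cvg_cst.
    by apply: cvgM; [exact: nbhs_dnbhs | exact: cvg_cst].
  apply: cvg_trans p0; apply: near_eq_cvg; near=> h.
  have h0 : h != 0 by near: h; exact: nbhs_dnbhs_neq.
  rewrite /p /GRing.scale/= mulmxDr !dotv_expand -!scalemxAr !dotv_expand.
  rewrite (dotv_mulmx C x v) C_sym (dotvC v (C *m x)).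
  by field.
split; [exact: cvgP cvg_quot | exact: cvg_lim].
Unshelve. all: by end_near. Qed.

End QuadraticDerivative.

(** * Block structure and the consensus matrix *)

Section Blocks.
Context {R : realType} {K M : nat}.
Implicit Types (x y : 'cV[R]_(K * M)) (w : 'cV[R]_M).

Definition stack (G : 'I_K -> 'cV[R]_M) : 'cV[R]_(K * M) :=
  \col_i G (mxtens_unindex i).1 (mxtens_unindex i).2 0.

Lemma block_stack G k : block (stack G) k = G k.
Proof. by apply/colP => j; rewrite !mxE mxtens_indexK. Qed.

Lemma blockP x y : (forall k, block x k = block y k) -> x = y.
Proof.
move=> xy; apply/colP => i; rewrite -(mxtens_unindexK i).
case: (mxtens_unindex i) => k j.
by have /colP/(_ j) := xy k; rewrite !mxE.
Qed.

Lemma blockD x y k : block (x + y) k = block x k + block y k.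
Proof. by apply/colP => j; rewrite !mxE. Qed.

Lemma blockZ a x k : block (a *: x) k = a *: block x k.
Proof. by apply/colP => j; rewrite !mxE. Qed.

Lemma blockN x k : block (- x) k = - block x k.
Proof. by rewrite -scaleN1r blockZ scaleN1r. Qed.

Lemma block_kron_ones w k : block (kron_ones K w) k = w.
Proof. by apply/colP => j; rewrite !mxE mxtens_indexK/= ord1 mul1r. Qed.

Lemma sum_mxtens (F : 'I_(K * M) -> R) :
  \sum_i F i = \sum_k \sum_j F (mxtens_index (k, j)).
Proof.
rewrite pair_bigA (reindex (@mxtens_index K M)) /=.
  by apply: eq_bigr => -[k j].
exists (@mxtens_unindex K M) => i _; first exact: mxtens_indexK.
exact: mxtens_unindexK.
Qed.

Lemma dotv_blocks x y : dotv x y = \sum_k dotv (block x k) (block y k).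
Proof.
rewrite dotvE sum_mxtens.
apply: eq_bigr => k _; rewrite dotvE; apply: eq_bigr => j _.
by rewrite !mxE.
Qed.

Lemma block_consensus (A : 'M[R]_K) x k :
  block (consensus_mx M A *m x) k =
  2^-1 *: (block x k - \sum_l A k l *: block x l).
Proof.
rewrite /consensus_mx -scalemxAl blockZ mulmxBl mul1mx blockD blockN.
congr (_ *: (_ - _)); apply/colP => j.
rewrite !mxE summxE sum_mxtens.
apply: eq_bigr => l _; rewrite !mxE (bigD1 j)//= big1 ?addr0.
  by rewrite tensmxE mxE eqxx mulr1.
by move=> i ij; rewrite tensmxE mxE eq_sym (negPf ij) mulr0 mul0r.
Qed.

End Blocks.

Section StochasticMatrix.
Context {R : realType} {K : nat}.
Variable A : 'M[R]_K.
Hypothesis A_stoch : doubly_stochastic A.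

Lemma stochastic_pow_row_sum p i : \sum_j (A ^+ p) i j = 1.
Proof.
have [_ A1 _] := A_stoch.
have Ap1 : A ^+ p *m const_mx 1 = (const_mx 1 : 'cV_K).
  elim: p => [|p IHp]; first by rewrite expr0 mul1mx.
  by rewrite exprS -mulmxE -mulmxA IHp.
have /colP/(_ i) := Ap1; rewrite !mxE => <-.
by apply: eq_bigr => j _; rewrite mxE mulr1.
Qed.

(** Maximum principle: at an index m where x is maximal, x m is an average of
    all entries with the positive weights of row m of a power of A. *)
Lemma primitive_fixed_constant (x : 'cV[R]_K) : primitive A ->
  A *m x = x -> forall i j, x i 0 = x j 0.
Proof.
move=> [p Ap_gt0] Ax.
have Apx : A ^+ p *m x = x.
  elim: p {Ap_gt0} => [|p IHp]; first by rewrite expr0 mul1mx.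
  by rewrite exprSr -mulmxE -mulmxA Ax.
suff max_const m : (forall j, x j 0 <= x m 0) -> forall j, x j 0 = x m 0.
  move=> i j.
  have [m _ mP] := @arg_maxP _ R _ i xpredT (fun k => x k 0) erefl.
  by rewrite !(max_const m) // => k; exact: mP.
move=> m_max j; apply/eqP; rewrite eq_sym -subr_eq0.
have gap_ge0 k : true -> 0 <= (A ^+ p) m k * (x m 0 - x k 0).
  by move=> _; rewrite mulr_ge0 ?subr_ge0// ltW.
have gap0 : \sum_k (A ^+ p) m k * (x m 0 - x k 0) = 0.
  under eq_bigr do rewrite mulrBr.
  rewrite sumrB -mulr_suml stochastic_pow_row_sum mul1r.
  by have /colP/(_ m) := Apx; rewrite mxE => ->; rewrite subrr.
have /eqP := psumr_eq0P gap_ge0 gap0 (isT : xpredT j).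
by rewrite mulf_eq0 gt_eqF.
Qed.

End StochasticMatrix.

Section ConsensusMatrix.
Context {R : realType} {K M : nat}.
Variable A : 'M[R]_K.
Hypotheses (A_sym : A^T = A) (A_stoch : doubly_stochastic A).
Local Notation B := (consensus_mx M A).

Lemma consensus_sym : B^T = B.
Proof. by rewrite /consensus_mx linearZ linearB /= trmx_tens A_sym !trmx1. Qed.

Lemma consensus_kron_ones w : B *m kron_ones K w = 0.
Proof.
apply: blockP => k; rewrite block_consensus.
under eq_bigr do rewrite block_kron_ones.
rewrite block_kron_ones -scaler_suml.
have := stochastic_pow_row_sum A_stoch 1 k; rewrite expr1 => ->.
by rewrite scale1r subrr scaler0; apply/colP => j; rewrite !mxE.
Qed.

Lemma consensus_ker_constant (x : 'cV[R]_(K * M)) : primitive A -> B *m x = 0 ->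
  forall k l, block x k = block x l.
Proof.
move=> A_prim Bx0 k l; apply/colP => j.
pose xj : 'cV[R]_K := \col_k block x k j 0.
suff /(primitive_fixed_constant A_stoch A_prim)/(_ k l) : A *m xj = xj.
  by rewrite !mxE.
apply/colP => i; have := block_consensus A x i; rewrite Bx0.
move=> /colP/(_ j); rewrite !mxE => /esym/eqP.
rewrite mulf_eq0 invr_eq0 pnatr_eq0/= subr_eq0 => /eqP ->.
by rewrite summxE; apply: eq_bigr => m _; rewrite !mxE.
Qed.

(** Fredholm alternative for the symmetric matrix B: the columns of cokermx B
    span the kernel of B, whose elements have equal blocks and are thus
    orthogonal to x. *)
Lemma consensus_range (x : 'cV[R]_(K * M)) : primitive A ->
  \sum_k block x k = 0 -> exists t, x = B *m t.
Proof.
move=> A_prim x_bal.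
suff /submxP[t xt] : (x^T <= B)%MS.
  by exists t^T; rewrite -consensus_sym -trmx_mul -xt trmxK.
rewrite submxE; apply/eqP/rowP => j; rewrite [RHS]mxE.
have Bcol : B *m col j (cokermx B) = 0.
  by rewrite colE mulmxA mulmx_coker mul0mx.
have -> : (x^T *m cokermx B) 0 j = dotv x (col j (cokermx B)).
  by rewrite /dotv !mxE; apply: eq_bigr => i _; rewrite !mxE.
have constant := consensus_ker_constant A_prim Bcol.
rewrite dotv_blocks; have [k _|K0] := pickP 'I_K; last first.
  by rewrite big1// => k; have := K0 k.
under eq_bigr do rewrite (constant _ k).
by rewrite -dotv_suml x_bal dotvC dotv0r.
Qed.

End ConsensusMatrix.

(** * Gradients of the network costs *)

Section NetworkGradients.
Context {R : realType} {K M : nat}.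
Variable J : 'I_K -> 'cV[R]_M -> R.
Hypothesis J_diff : forall k w, differentiable (J k : _ -> R^o) w.

Definition grad_stack (x : 'cV[R]_(K * M)) :=
  stack (fun k => gradient (J k) (block x k)).

Lemma is_derive_avg_cost w v :
  is_derive w v (avg_cost J : _ -> R^o)
    (dotv (K%:R^-1 *: \sum_k gradient (J k) w) v).
Proof.
have -> : (avg_cost J : _ -> R^o) = K%:R^-1 \*: \sum_k (J k : _ -> R^o).
  by apply/funext => z; rewrite /avg_cost /= fct_sumE.
rewrite dotvZl dotv_suml.
apply: is_deriveZ; apply: is_derive_sum => k.
by apply: DeriveDef; [exact: diff_derivable | exact: derive_gradient].
Qed.

Lemma gradient_avg_cost w :
  gradient (avg_cost J) w = K%:R^-1 *: \sum_k gradient (J k) w.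
Proof. by apply: gradientP => v; exact: is_derive_avg_cost. Qed.

Lemma is_derive_block k x v :
  is_derive x v (fun x => J k (block x k) : R^o)
    (dotv (gradient (J k) (block x k)) (block v k)).
Proof.
apply: (is_derive_affine_comp (L := fun x => block x k)) => // h.
by rewrite blockD blockZ.
Qed.

Lemma gradient_penalized_cost (Bh : 'M[R]_(K * M)) mu x :
  Bh^T = Bh -> mu != 0 ->
  gradient (penalized_cost J Bh mu) x =
  grad_stack x + mu^-1 *: (Bh *m Bh *m x).
Proof.
move=> Bh_sym mu0; apply: gradientP => v.
pose quad : 'cV[R]_(K * M) -> R^o := fun w => dotv w (Bh *m Bh *m w).
have -> : (penalized_cost J Bh mu : _ -> R^o) =
    \sum_k (fun x => J k (block x k) : R^o) + (2 * mu)^-1 \*: quad.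
  apply/funext => z; rewrite /penalized_cost /sum_cost enorm_sqr.
  congr (_ + _); first by rewrite fct_sumE.
  by rewrite /quad /GRing.scale/= -mulmxA [X in _ = _ * X]dotv_mulmx Bh_sym.
have -> : dotv (grad_stack x + mu^-1 *: (Bh *m Bh *m x)) v =
    \sum_k dotv (gradient (J k) (block x k)) (block v k) +
    (2 * mu)^-1 *: (2 * dotv (Bh *m Bh *m x) v).
  rewrite dotvDl dotvZl dotv_blocks; congr (_ + _).
    by apply: eq_bigr => k _; rewrite block_stack.
  by rewrite /GRing.scale/=; field.
apply: is_deriveD; first by apply: is_derive_sum => k; exact: is_derive_block.
apply: is_deriveZ; apply: is_derive_quadratic.
by rewrite trmx_mul Bh_sym.
Qed.

End NetworkGradients.

(** * Estimates for one primal-dual step *)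

Section ScalarInequalities.
Context {R : realType}.
Implicit Types (p r s rho nu delta c m X Y : R).

(** Here p and r are the norms of the consensus and disagreement parts of an
    error, X its gradient term and Y its penalty. If r <= c p, the gradient
    term controls p and the penalty controls r; if c p <= r, the penalty alone
    controls both. *)
Lemma penalty_strengthens nu delta c rho s m p r X Y :
  0 <= p -> 0 <= r -> 0 < c -> 0 <= delta -> 0 < rho -> 0 < m ->
  m <= nu - 2 * delta * c -> m <= rho * s * c ^+ 2 / (4 * (c ^+ 2 + 1)) ->
  0 <= X -> nu * p ^+ 2 - 2 * delta * (p * r) <= X -> s * r ^+ 2 <= Y ->
  m * (p ^+ 2 + r ^+ 2) <= X + rho * Y.
Proof.
move=> p0 r0 c0 d0 rho0 m0 mnu mrho X0 Xge Yge.
have c2 : 0 < c ^+ 2 by rewrite exprn_gt0.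
have m4 : m * (4 * (c ^+ 2 + 1)) <= rho * s * c ^+ 2.
  by rewrite -ler_pdivlMr// mulr_gt0// addr_gt0.
have rhoY : rho * s * r ^+ 2 <= rho * Y by rewrite -mulrA ler_pM2l.
have r2 : 0 <= r ^+ 2 by exact: sqr_ge0.
have [rcp|cpr] := leP r (c * p).
  have prp : p * r <= c * p ^+ 2 by rewrite expr2 mulrCA ler_wpM2l.
  have m_le : m <= rho * s by rewrite -(ler_pM2r c2); nra.
  have : 2 * delta * (p * r) <= 2 * delta * (c * p ^+ 2).
    by rewrite ler_wpM2l// mulr_ge0.
  have : m * r ^+ 2 <= rho * s * r ^+ 2 by rewrite ler_wpM2r.
  have : m * p ^+ 2 <= (nu - 2 * delta * c) * p ^+ 2.
    by rewrite ler_wpM2r ?sqr_ge0.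
  lra.
have cp2 : c ^+ 2 * p ^+ 2 <= r ^+ 2.
  by rewrite -exprMn ler_sqr ?nnegrE ?mulr_ge0// ltW.
suff : m * (p ^+ 2 + r ^+ 2) <= rho * s * r ^+ 2 by lra.
rewrite -(ler_pM2r c2).
have : m * (c ^+ 2 * p ^+ 2) <= m * r ^+ 2 by rewrite ler_pM2l.
have : m * (4 * (c ^+ 2 + 1)) * r ^+ 2 <= rho * s * c ^+ 2 * r ^+ 2.
  by rewrite ler_wpM2r.
have : 0 <= m * (c ^+ 2 + 1) * r ^+ 2.
  by rewrite !mulr_ge0// ?ltW// addr_gt0.
lra.
Qed.

End ScalarInequalities.

Section PrimalDualStep.
Context {R : realType} {n : nat}.

(** With y = S t the claim is the hypothesis at t, as <t, S S t> = |y|^2 and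
    |S S t|^2 = |S y|^2. *)
Lemma sqrt_range_coercive (S : 'M[R]_n) smin y : S^T = S ->
  (forall t, smin * dotv t (S *m S *m t) <= dotv (S *m S *m t) (S *m S *m t)) ->
  (exists t, y = S *m t) -> smin * dotv y y <= dotv (S *m y) (S *m y).
Proof.
move=> S_sym smin_le [t ->]; have := smin_le t.
by rewrite -mulmxA (dotv_mulmx S t) S_sym.
Qed.

(** The dual update contributes 2 <S y, z>, and substituting x = z + S y in
    |x|^2 contributes the same cross term. *)
Lemma primal_dual_energy (S : 'M[R]_n) alpha (x y z y' : 'cV[R]_n) : S^T = S ->
  alpha != 0 -> z = x - S *m y -> y' = y + alpha *: (S *m z) ->
  dotv z z - alpha * dotv z (S *m S *m z) + alpha^-1 * dotv y' y' =
  dotv x x + alpha^-1 * dotv y y - dotv (S *m y) (S *m y).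
Proof.
move=> S_sym alpha0 zE y'E.
have -> : x = z + S *m y by rewrite zE subrK.
rewrite y'E -mulmxA (dotv_mulmx S z) S_sym !dotv_expand.
rewrite (dotvC (S *m z) y) (dotvC (S *m y) z) (dotv_mulmx S z) S_sym.
by rewrite (dotvC (S *m z) y); field.
Qed.

Lemma wnormsq_shift (C : 'M[R]_n) alpha x :
  wnormsq (1%:M - alpha *: C) x = dotv x x - alpha * dotv x (C *m x).
Proof.
by rewrite wnormsqE mulmxBl mul1mx -scalemxAl dotvDr dotvNr dotvZr.
Qed.

(** |a + b|^2 <= (p + q) (|a|^2 / p + |b|^2 / q) with a = mu g, b = C e,
    p = mu delta and q = smax: the hypotheses bound |a|^2 / p by mu <e, g> and
    |b|^2 / q by <e, C e>, so that mu g + C e is (mu delta + smax)-cocoercive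
    in e. *)
Lemma gradient_step_norm (C : 'M[R]_n) delta smax mu (e g : 'cV[R]_n) :
  0 < delta -> 0 < smax -> 0 < mu ->
  dotv g g <= delta * dotv e g ->
  dotv (C *m e) (C *m e) <= smax * dotv e (C *m e) ->
  dotv (e - mu *: g - C *m e) (e - mu *: g - C *m e) <=
  dotv e e - (2 - smax - mu * delta) * (mu * dotv e g + dotv e (C *m e)).
Proof.
move=> d0 s0 mu0 gg CC.
move: (C *m e) CC => b bb.
have := dotv_ge0 (smax *: (mu *: g) - (mu * delta) *: b).
have md : 0 < mu * delta by rewrite mulr_gt0.
rewrite !dotv_expand (dotvC g e) (dotvC b e) (dotvC b g) => sq.
have gb : 2 * mu * dotv g b <=
    mu ^+ 2 * dotv g g * (smax / (mu * delta)) +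
    dotv b b * (mu * delta / smax).
  rewrite -subr_ge0 -(pmulr_rge0 _ (mulr_gt0 s0 md)).
  apply: le_trans sq _; rewrite le_eqVlt; apply/orP; left; apply/eqP.
  by field; rewrite !gt_eqF.
have g1 : mu ^+ 2 * dotv g g * (1 + smax / (mu * delta))
    <= (mu * delta + smax) * (mu * dotv e g).
  rewrite [leLHS](_ : _ = (mu * delta + smax) * (mu * (dotv g g / delta))).
    by rewrite ler_pM2l ?addr_gt0// ler_pM2l// ler_pdivrMr// mulrC.
  by field; rewrite !gt_eqF.
have b1 : dotv b b * (1 + mu * delta / smax)
    <= (mu * delta + smax) * dotv e b.
  rewrite [leLHS](_ : _ = (mu * delta + smax) * (dotv b b / smax)).
    by rewrite ler_pM2l ?addr_gt0// ler_pdivrMr// mulrC.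
  by field; rewrite !gt_eqF.
lra.
Qed.

End PrimalDualStep.

Section NetworkEstimates.
Context {R : realType} {K M : nat}.
Variable J : 'I_K -> 'cV[R]_M -> R.
Variables (delta nu : R).
Hypothesis J_convex : forall k, convex_function setT (J k).
Hypothesis J_diff : forall k (w : 'cV[R]_M), differentiable (J k : _ -> R^o) w.
Hypothesis J_smooth : forall k (u v : 'cV[R]_M),
  enorm (gradient (J k) u - gradient (J k) v) <= delta * enorm (u - v).
Hypothesis delta_gt0 : 0 < delta.
Hypothesis Jbar_strong : forall u v : 'cV[R]_M,
  nu * enorm (u - v) ^+ 2
  <= dotv (u - v) (gradient (avg_cost J) u - gradient (avg_cost J) v).

Local Notation G := (@grad_stack R K M J).

Lemma grad_stack_cocoercive x y :
  dotv (G x - G y) (G x - G y) <= delta * dotv (x - y) (G x - G y).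
Proof.
rewrite !dotv_blocks mulr_sumr ler_sum// => k _.
rewrite !blockD !blockN !block_stack.
exact: cocoercive_gradient delta_gt0 (@J_convex k) (@J_diff k) (@J_smooth k).
Qed.

Lemma grad_stack_monotone x y : 0 <= dotv (x - y) (G x - G y).
Proof.
rewrite -(pmulr_rge0 _ delta_gt0).
by apply: le_trans (grad_stack_cocoercive x y); exact: dotv_ge0.
Qed.

Lemma grad_stack_lipschitz x y : enorm (G x - G y) <= delta * enorm (x - y).
Proof.
have [->|g0] := eqVneq (enorm (G x - G y)) 0.
  by rewrite mulr_ge0 ?enorm_ge0// ltW.
have g_gt0 : 0 < enorm (G x - G y) by rewrite lt_neqAle eq_sym g0 enorm_ge0.
rewrite -(ler_pM2r g_gt0) -expr2 enorm_sqr -mulrA.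
apply: (le_trans (grad_stack_cocoercive x y)).
by rewrite ler_pM2l// cauchy_schwarz.
Qed.

Hypothesis K_gt0 : (0 < K)%N.

(** At vectors with equal blocks the stacked gradients see only the average
    cost, up to the factor K also present in the squared norm. *)
Lemma consensus_grad_strong u v :
  nu * dotv (kron_ones K u - kron_ones K v) (kron_ones K u - kron_ones K v) <=
  dotv (kron_ones K u - kron_ones K v) (G (kron_ones K u) - G (kron_ones K v)).
Proof.
have K0 : 0 < K%:R :> R by rewrite ltr0n.
rewrite !dotv_blocks.
under eq_bigr do rewrite blockD blockN !block_kron_ones.
under [leRHS]eq_bigr do rewrite !blockD !blockN !block_stack !block_kron_ones.
rewrite sumr_const card_ord -mulr_natl mulrCA -ler_pdivlMl// -enorm_sqr.
apply: (le_trans (Jbar_strong u v)).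
rewrite !gradient_avg_cost// -scalerBr dotvZr dotvC -sumrB dotv_suml.
by rewrite ler_pM2l ?invr_gt0// ler_sum// => k _; rewrite dotvC.
Qed.

Variables (A : 'M[R]_K) (smin : R).
Hypotheses (A_sym : A^T = A) (A_stoch : doubly_stochastic A).
Hypothesis A_prim : primitive A.
Local Notation B := (consensus_mx M A).
Hypothesis B_coercive : forall v, (exists t, v = B *m t) ->
  smin * dotv v v <= dotv v (B *m v).

(** Let m be the mean of the blocks of x. The error e splits into orthogonal
    parts u (m against w, of norm p) and v (x against m, of norm r). Passing
    through the consensus point m splits g likewise: <u, g1> is bounded below by
    strong convexity, <v, g2> is nonnegative by monotonicity, and each of the
    two cross terms costs at most delta p r. The penalty sees only v, which lies
    in the range of B. *)
Lemma consensus_decomposition (x : 'cV[R]_(K * M)) (w : 'cV[R]_M) :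
  let e := x - kron_ones K w in let g := G x - G (kron_ones K w) in
  exists p r : R, [/\ 0 <= p, 0 <= r, dotv e e = p ^+ 2 + r ^+ 2,
    nu * p ^+ 2 - 2 * delta * (p * r) <= dotv e g &
    smin * r ^+ 2 <= dotv e (B *m e)].
Proof.
move=> e g; pose m := K%:R^-1 *: \sum_k block x k.
pose u := kron_ones K m - kron_ones K w; pose v := x - kron_ones K m.
have eE : e = u + v by rewrite /e /u /v [RHS]addrC addrA subrK.
have v_bal : \sum_k block v k = 0.
  under eq_bigr do rewrite blockD blockN block_kron_ones.
  rewrite sumrB sumr_const card_ord -scaler_nat scalerA mulfV ?scale1r ?subrr//.
  by rewrite pnatr_eq0 -lt0n.
have uv0 : dotv v u = 0.
  rewrite dotv_blocks /u.
  under eq_bigr do rewrite (blockD (kron_ones K m)) blockN !block_kron_ones.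
  by rewrite -dotv_suml v_bal dotvC dotv0r.
have Bu : B *m u = 0 by rewrite mulmxBr !consensus_kron_ones// subr0.
have B_v : smin * dotv v v <= dotv v (B *m v).
  by apply: B_coercive; exact: consensus_range.
pose g1 := G (kron_ones K m) - G (kron_ones K w).
pose g2 := G x - G (kron_ones K m).
have gE : g = g2 + g1 by rewrite /g /g1 /g2 addrA subrK.
have h1 : nu * enorm u ^+ 2 <= dotv u g1.
  by rewrite enorm_sqr consensus_grad_strong.
have h2 : dotv (- u) g2 <= enorm u * (delta * enorm v).
  by apply: dotv_le_enorm; [rewrite enormN | exact: grad_stack_lipschitz].
have h3 : 0 <= dotv v g2 by exact: grad_stack_monotone.
have h4 : dotv (- v) g1 <= enorm v * (delta * enorm u).
  by apply: dotv_le_enorm; [rewrite enormN | exact: grad_stack_lipschitz].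
rewrite eE gE; clearbody u v g1 g2.
exists (enorm u), (enorm v); split; rewrite ?enorm_ge0//.
- by rewrite !enorm_sqr !dotv_expand (dotvC u v) uv0; ring.
- by move: h2 h4; rewrite !dotv_expand; lra.
- rewrite mulmxDr Bu add0r dotvDl dotv_mulmx consensus_sym// Bu dotvC dotv0r.
  by rewrite add0r enorm_sqr.
Qed.

End NetworkEstimates.

Lemma geometric_decay (R : realType) (gamma : R) (V : nat -> R) : 0 <= gamma ->
  (forall i, V i.+1 <= gamma * V i) -> forall i, V i <= V 0%N * gamma ^+ i.
Proof.
move=> gamma_ge0 V_step; elim=> [|i IHi]; first by rewrite expr0 mulr1.
apply: (le_trans (V_step i)).
by rewrite exprS mulrCA ler_wpM2l.
Qed.

(** * Linear convergence *)

Theorem theorem2 (R : realType) (K M : nat) (J : 'I_K -> 'cV[R]_M -> R)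
    (delta nu : R) (wstar : 'cV[R]_M) (A : 'M[R]_K) (Bh : 'M[R]_(K * M))
    (sigma_max sigma_min c mu alpha : R)
    (K_ge2 : (2 <= K)%N) (M_gt0 : (0 < M)%N)
    (J_convex : forall k, convex_function setT (J k))
    (J_diff : forall k (w : 'cV[R]_M), differentiable (J k : 'cV[R]_M -> R^o) w)
    (J_smooth : forall k (u v : 'cV[R]_M),
        enorm (gradient (J k) u - gradient (J k) v) <= delta * enorm (u - v))
    (Jbar_strong : forall u v : 'cV[R]_M,
        nu * enorm (u - v) ^+ 2
        <= dotv (u - v) (gradient (avg_cost J) u - gradient (avg_cost J) v))
    (nu_gt0 : 0 < nu) (nu_le_delta : nu <= delta)
    (wstar_min : forall w : 'cV[R]_M, avg_cost J wstar <= avg_cost J w)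
    (A_sym : A^T = A) (A_stoch : doubly_stochastic A)
    (A_prim : primitive A)
    (Bh_sqrt : psd_sqrt_of (consensus_mx M A) Bh)
    (sigma_maxP : largest_singular_value (consensus_mx M A) sigma_max)
    (sigma_minP : smallest_nonzero_singular_value (consensus_mx M A) sigma_min)
    (c_gt0 : 0 < c) (c_lt : c < nu / (2 * delta))
    (mu_gt0 : 0 < mu) (mu_lt : mu < (1 - sigma_max) / delta)
    (alpha_gt0 : 0 < alpha) (alpha_le1 : alpha <= 1) :
  exists rho : R, 0 < rho /\
    let nu_rho := Num.min (nu - 2 * delta * c)
                          (rho * sigma_min * c ^+ 2 / (4 * (c ^+ 2 + 1))) in
    let Q := 1%:M - alpha *: consensus_mx M A in
    let gamma := Num.max (1 - mu * nu_rho * (2 - sigma_max - mu * delta))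
                         (1 - alpha * sigma_min) in
    [/\ 0 < nu_rho, posdef Q, gamma < 1 &
        forall w y z : nat -> 'cV[R]_(K * M),
          primal_dual_recursion J Bh mu alpha w y z ->
          y 0%N = 0 ->
          exists C : R, 0 < C /\
            forall i : nat,
              wnormsq Q (w i - kron_ones K wstar) <= C * gamma ^+ i].
Proof.
have delta_gt0 : 0 < delta by exact: lt_le_trans nu_gt0 nu_le_delta.
set B := consensus_mx M A in Bh_sqrt sigma_maxP sigma_minP *.
have [[Bh_sym _] BhB] := Bh_sqrt.
have B_sym : B^T = B by exact: consensus_sym.
have B_quad x : dotv x (B *m x) = dotv (Bh *m x) (Bh *m x).
  by rewrite -BhB -mulmxA dotv_mulmx Bh_sym.
have B_psd x : 0 <= dotv x (B *m x) by rewrite B_quad dotv_ge0.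
have B_spec := psd_spectral_bounds B_sym B_psd sigma_maxP sigma_minP.
have smin0 : 0 < sigma_min := smin_gt0 sigma_minP.
have smin_le := smin_le_smax sigma_maxP sigma_minP.
have smax0 : 0 < sigma_max by exact: lt_le_trans smin_le.
pose theta := 2 - sigma_max - mu * delta.
have theta_gt1 : 1 < theta by move: mu_lt; rewrite ltr_pdivlMr// /theta; lra.
have theta_gt0 : 0 < theta by lra.
have mud0 : 0 < mu * delta by rewrite mulr_gt0.
have smax1 : sigma_max < 1 by move: mu_lt; rewrite ltr_pdivlMr//; lra.
have range_coercive y : (exists t, y = Bh *m t) ->
    sigma_min * dotv y y <= dotv (Bh *m y) (Bh *m y).
  by apply: sqrt_range_coercive => // t; rewrite BhB; case: (B_spec t).
have B_coercive v : (exists t, v = B *m t) ->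
    sigma_min * dotv v v <= dotv v (B *m v).
  move=> [t ->]; rewrite B_quad; apply: range_coercive.
  by exists (Bh *m t); rewrite mulmxA BhB.
(* The solution of theta (1 - mu rho) = 1. *)
pose rho := (theta - 1) / (mu * theta).
have rho_gt0 : 0 < rho by rewrite divr_gt0 ?mulr_gt0// subr_gt0.
have rhoE : theta * mu * rho = theta - 1.
  by rewrite /rho; field; rewrite !gt_eqF.
exists rho; clearbody rho; split=> // nu_rho Q gamma.
have nu_rho_gt0 : 0 < nu_rho.
  rewrite lt_min; apply/andP; split.
    by move: c_lt; rewrite ltr_pdivlMr ?mulr_gt0// subr_gt0 mulrC.
  have c2_gt0 : 0 < c ^+ 2 by exact: exprn_gt0.
  by rewrite divr_gt0// !mulr_gt0// addr_gt0.
have Q_pos x : x != 0 -> 0 < wnormsq Q x.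
  move=> x0; rewrite wnormsq_shift.
  have xx : 0 < dotv x x by rewrite lt_neqAle eq_sym dotv_eq0 x0 dotv_ge0.
  have [_ _ Bx] := B_spec x.
  have : alpha * dotv x (B *m x) <= dotv x (B *m x) by rewrite ler_piMl.
  have : sigma_max * dotv x x < dotv x x by rewrite gtr_pMl.
  lra.
have Q_ge0 x : 0 <= wnormsq Q x.
  have [->|x0] := eqVneq x 0; last by rewrite ltW ?Q_pos.
  by rewrite wnormsqE mulmx0 dotv0r.
have gamma_lt1 : gamma < 1.
  by rewrite gt_max !gtrBl !mulr_gt0.
have gamma_ge0 : 0 <= gamma.
  rewrite le_max; apply/orP; right; rewrite subr_ge0.
  by rewrite mulr_ile1 ?(ltW alpha_gt0) ?(ltW smin0)//; lra.
split=> //.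
  by split=> //; rewrite linearB linearZ/= trmx1 B_sym.
move=> w y z rec y00.
set ws := kron_ones K wstar.
pose G := @grad_stack R K M J.
have Bws : B *m ws = 0 by exact: consensus_kron_ones.
have Bhws : Bh *m ws = 0.
  by apply/eqP; rewrite -dotv_eq0 -B_quad Bws dotv0r.
have K0 : K%:R != 0 :> R by rewrite pnatr_eq0 -lt0n ltnW.
have Gws_bal : \sum_k block (G ws) k = 0.
  under eq_bigr do rewrite block_stack block_kron_ones.
  have : K%:R^-1 *: \sum_k gradient (J k) wstar = 0.
    by apply: minimizer_gradient0 wstar_min => v; exact: is_derive_avg_cost.
  by move/eqP; rewrite scaler_eq0 invr_eq0 (negPf K0) => /eqP.
(* wstar is optimal, so the dual fixed point ys exists. *)
have [t Gws] : exists t, G ws = B *m t by exact: consensus_range.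
pose ys := - (mu *: (Bh *m t)).
(* Both 0 - ys and the dual increments lie in the range of Bh. *)
have y_range i : exists s, y i - ys = Bh *m s.
  elim: i => [|i [s ys_eq]].
    by exists (mu *: t); rewrite y00 sub0r opprK -scalemxAr.
  exists (s + alpha *: z i.+1); have [_ -> _] := rec i.
  by rewrite addrAC ys_eq mulmxDr -scalemxAr.
pose V i := wnormsq Q (w i - ws) + alpha^-1 * dotv (y i - ys) (y i - ys).
have V_step i : V i.+1 <= gamma * V i.
  have [zE yE wE] := rec i.
  set e := w i - ws; set g := G (w i) - G ws.
  pose x := e - mu *: g - B *m e.
  have wE' : w i.+1 - ws = x - Bh *m (y i - ys).
    rewrite wE zE gradient_penalized_cost ?gt_eqF// BhB.
    rewrite scalerDr scalerA mulfV ?gt_eqF// scale1r.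
    have -> : Bh *m (y i - ys) = Bh *m y i + mu *: G ws.
      by rewrite mulmxBr mulmxN opprK -scalemxAr mulmxA BhB Gws.
    rewrite /x /e /g (mulmxBr B) Bws subr0 scalerBr.
    have shuffle (a b1 b2 d1 d2 p : 'cV[R]_(K * M)) :
        a - (b1 + b2) - d1 - p = a - p - (b1 - d2) - b2 - (d1 + d2).
      by apply/colP => j; rewrite !mxE; ring.
    exact: shuffle.
  have yE' : y i.+1 - ys = (y i - ys) + alpha *: (Bh *m (w i.+1 - ws)).
    by rewrite yE wE mulmxBr Bhws subr0 addrAC.
  have := primal_dual_energy Bh_sym (lt0r_neq0 alpha_gt0) wE' yE'.
  rewrite BhB -wnormsq_shift -/Q => VE.
  have [p [r [p0 r0 eeE X_ge Y_ge]]] :=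
    consensus_decomposition J_convex J_diff J_smooth delta_gt0 Jbar_strong
     (ltnW K_ge2) A_sym A_stoch A_prim B_coercive (w i) wstar.
  rewrite -/ws -/e -/G -/g -/B in eeE X_ge Y_ge.
  have X_ge0 : 0 <= dotv e g by exact: grad_stack_monotone.
  have nu_rho1 : nu_rho <= nu - 2 * delta * c by rewrite ge_min lexx.
  have nu_rho2 : nu_rho <= rho * sigma_min * c ^+ 2 / (4 * (c ^+ 2 + 1)).
    by rewrite ge_min lexx orbT.
  have strong := penalty_strengthens p0 r0 c_gt0 (ltW delta_gt0) rho_gt0
    nu_rho_gt0 nu_rho1 nu_rho2 X_ge0 X_ge Y_ge.
  rewrite -eeE in strong.
  have [_ BB_le _] := B_spec e.
  have xx_le := gradient_step_norm delta_gt0 smax0 mu_gt0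
    (grad_stack_cocoercive J_convex J_diff J_smooth delta_gt0 (w i) ws) BB_le.
  rewrite -/e -/G -/g -/x -/theta in xx_le.
  have primal : dotv x x <= gamma * wnormsq Q e.
    have Y_ge0 := B_psd e.
    have Q_e : 0 <= dotv e e - alpha * dotv e (B *m e).
      by rewrite -wnormsq_shift Q_ge0.
    have aY : alpha * dotv e (B *m e) <= dotv e (B *m e) by rewrite ler_piMl.
    have tm_gt0 : 0 < theta * mu by exact: mulr_gt0.
    (* nu_rho |e|^2 <= <e, g> + rho <e, B e>, scaled so that rhoE applies. *)
    have tmX : theta * mu * nu_rho * dotv e e
        <= theta * mu * dotv e g + (theta - 1) * dotv e (B *m e).
      by rewrite -rhoE -!mulrA -!mulrDr ler_pM2l ?ler_pM2l// mulrA in strong *.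
    have aY' : 0 <= theta * mu * nu_rho * (alpha * dotv e (B *m e)).
      by rewrite !mulr_ge0// ltW.
    apply: (@le_trans _ _ ((1 - mu * nu_rho * theta) * wnormsq Q e)).
      rewrite wnormsq_shift; lra.
    by rewrite ler_wpM2r ?Q_ge0// le_max lexx.
  have dual : alpha^-1 * dotv (y i - ys) (y i - ys)
      - dotv (Bh *m (y i - ys)) (Bh *m (y i - ys))
      <= gamma * (alpha^-1 * dotv (y i - ys) (y i - ys)).
    have yy_ge0 : 0 <= alpha^-1 * dotv (y i - ys) (y i - ys).
      by rewrite mulr_ge0 ?dotv_ge0// invr_ge0 ltW.
    apply: (@le_trans _ _ ((1 - alpha * sigma_min) *
        (alpha^-1 * dotv (y i - ys) (y i - ys)))); last first.
      by rewrite ler_wpM2r// le_max lexx orbT.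
    rewrite mulrBl mul1r lerD2l lerN2 mulrACA mulfV ?gt_eqF// mul1r.
    exact: range_coercive.
  rewrite /V VE mulrDr -addrA; exact: lerD.
have V0 : 0 <= V 0%N.
  by rewrite addr_ge0 ?Q_ge0// mulr_ge0 ?dotv_ge0// invr_ge0 ltW.
exists (V 0%N + 1); split; first by rewrite ltr_wpDl.
move=> i; apply: (@le_trans _ _ (V i)).
  by rewrite lerDl mulr_ge0 ?dotv_ge0// invr_ge0 ltW.
apply: (le_trans (geometric_decay gamma_ge0 V_step i)).
by rewrite ler_wpM2r ?exprn_ge0// lerDl.
Qed.
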